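(* Let $f:\{0,1\}^5\to\{0,1\}$ be a radius-$2$ cellular automaton local rule with induced global rule $F$, and suppose there are integers $n_1\ge1$ and $n_2\ge1$ such that the following properties hold for every $L\ge5$: B1) for every $c\in\mathscr{C}_L$ such that $c\notin\{1^L\}$ if $L$ is odd, and $c\notin\{1^L,(01)^{L/2},(10)^{L/2}\}$ if $L$ is even, there is $0\le j\le L-1$ with $(F^{n_1}(c))_{[j,j+1]}=00$; B2) there is $0\le i\le L-1$ such that, for every $c\in\mathscr{C}_L$ and every $0\le j\le L-1$, if $c_{[j,j+1]}=00$ then $(F^{n_2}(c))_{[i+j,i+j+2]}=000$; B3) $f(0,1,0,1,0)=f(1,0,1,0,1)=f(1,1,1,1,1)=1$; B4) $f(0,0,0,0,0)=0$. Then $f$ is a consensus rule and, for every $L\ge5$, $\mathscr{B}_1^L=\{1^L\}$ if $L$ is odd and $\mathscr{B}_1^L=\{1^L,(10)^{L/2},(01)^{L/2}\}$ if $L$ is even.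
   Context: A radius-$2$ (binary, one-dimensional) cellular automaton local rule is a function $f:\{0,1\}^{5}\to\{0,1\}$. A configuration of length $L$ is a cyclic word $c=(c_0,\dots,c_{L-1})\in\{0,1\}^L=:\mathscr{C}_L$, with cell indices taken modulo $L$; $c_{[a,b]}=c_ac_{a+1}\cdots c_b$. The induced global rule $F:\mathscr{C}_L\to\mathscr{C}_L$ is $(F(c))_p=f(c_{p-2},c_{p-1},c_p,c_{p+1},c_{p+2})$, and $F^n$ is its $n$-th iterate. For a block $b$, $b^n$ denotes the concatenation of $n$ copies of $b$. An attractor of length $L$ of $F$ is a nonempty set $X\subseteq\mathscr{C}_L$ with $F(X)=X$ such that any nonempty $Y\subseteq X$ with $F(Y)=Y$ equals $X$ (i.e. a periodic orbit); if $X=\{x\}$ it is a fixed point and is identified with $x$. The basin of attraction of $X$ is $\{c\in\mathscr{C}_L: F^t(c)\in X\text{ for some }t\ge0\}$; $\mathscr{B}^L_x$ denotes the basin of attraction of $x^L$ for $x\in\{0,1\}$. The rule $f$ is a consensus rule if for every $L\ge5$ its only attractors of length $L$ are $0^L$ and $1^L$ (both being attractors). *)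

(* Defs.v *)
(* The alphabet {0,1} is bool, with 0 = false and 1 = true. *)
From mathcomp Require Import all_boot.
Set Implicit Arguments.
Unset Strict Implicit.
Unset Printing Implicit Defensive.

Definition local_rule := bool -> bool -> bool -> bool -> bool -> bool.

Notation config L := (L.-tuple bool).

(* The default [false] of [nth] is never used: for L > 0 the index is < L. *)
Definition cell (L : nat) (c : config L) (k : nat) : bool :=
  nth false c (k %% L).

(* The factor c_a c_(a+1) ... c_b of the cyclic word c, endpoints included. *)
Definition block (L : nat) (c : config L) (a b : nat) : seq bool :=
  [seq cell c k | k <- index_iota a b.+1].

Definition word_pow (b : seq bool) (n : nat) : seq bool := flatten (nseq n b).

Definition const_config (L : nat) (x : bool) : config L := [tuple of nseq L x].

(* p + (L - m) is p - m modulo L (for L = 1 too: every index is then 0). *)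
Definition global_rule (f : local_rule) (L : nat) (c : config L) : config L :=
  [tuple f (cell c (p + (L - 2))) (cell c (p + (L - 1))) (cell c p)
           (cell c (p + 1)) (cell c (p + 2)) | p < L].
Arguments global_rule f L c : clear implicits.

Definition attractor (f : local_rule) (L : nat) (X : {set config L}) : Prop :=
  [/\ X != set0,
      global_rule f L @: X = X &
      forall Y : {set config L},
        Y != set0 -> Y \subset X -> global_rule f L @: Y = Y -> Y = X].

Definition in_basin (f : local_rule) (L : nat) (X : {set config L})
    (c : config L) : Prop :=
  exists t : nat, iter t (global_rule f L) c \in X.

Definition consensus_rule (f : local_rule) : Prop :=
  forall L : nat, 5 <= L ->
  forall X : {set config L},
    attractor f X <->
    (X = [set const_config L false] \/ X = [set const_config L true]).

(* Main.v *)
(* By B2 a run of k >= 2 zeros produces, n2 steps later, a run of k + 1 zeros,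
   so every configuration containing 00 reaches 0^L.  By B1 this applies, after
   n1 steps, to every configuration other than 1^L, (01)^(L/2) and (10)^(L/2);
   those three are mapped to 1^L by B3.  Hence every orbit ends in one of the
   two fixed points 0^L and 1^L, and in 1^L only from these exceptions. *)
Require Import Defs.
From mathcomp Require Import all_boot.
From mathcomp Require Import zify.

Lemma cellDml {L} (c : config L) a k : cell c (a %% L + k) = cell c (a + k).
Proof. by rewrite /cell modnDml. Qed.

Lemma cell_global_rule f {L} (c : config L) k : 0 < L ->
  cell (global_rule f L c) k =
  f (cell c (k + (L - 2))) (cell c (k + (L - 1))) (cell c k)
    (cell c (k + 1)) (cell c (k + 2)).
Proof.
move=> L_gt0; have ltk : k %% L < L by rewrite ltn_mod.
have -> : cell (global_rule f L c) k = tnth (global_rule f L c) (Ordinal ltk).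
  by rewrite (tnth_nth false).
rewrite tnth_mktuple /= !cellDml.
by congr (f _ _ _ _ _); rewrite /cell modn_mod.
Qed.

Lemma cell_const_config L b k : 0 < L -> cell (const_config L b) k = b.
Proof. by move=> L_gt0; rewrite /cell /= nth_nseq ltn_mod L_gt0. Qed.

Lemma eq_const_config {L} b (c : config L) :
  (forall k, k < L -> cell c k = b) -> c = const_config L b.
Proof.
move=> cE; apply: val_inj; apply: (@eq_from_nth _ false) => [|k].
  by rewrite !size_tuple.
rewrite size_tuple => ltkL; rewrite /= nth_nseq ltkL -[RHS](cE k ltkL).
by rewrite /cell modn_small.
Qed.

Lemma global_rule_const f L b : 0 < L -> f b b b b b = b ->
  global_rule f L (const_config L b) = const_config L b.
Proof.
move=> L_gt0 fb; apply: eq_const_config => k _.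
by rewrite cell_global_rule // !cell_const_config.
Qed.

(** Leaving [b] free treats $(01)^n$ and $(10)^n$ together: the letter depends only on [b] and the
    parity of the index. *)
Lemma nth_word_pow2 b n k : k < n.*2 ->
  nth false (word_pow [:: b; ~~ b] n) k = b (+) odd k.
Proof.
rewrite /word_pow; elim: n k => [|n IHn] [|[|k]] //= ltk.
- by rewrite addbF.
- by rewrite addbT.
- by rewrite negbK IHn.
Qed.

Lemma cell_word_pow2 {L b} {c : config L} k : 0 < L -> ~~ odd L ->
  val c = word_pow [:: b; ~~ b] (L %/ 2) -> cell c k = b (+) odd k.
Proof.
move=> L_gt0 evenL cE; rewrite /cell cE nth_word_pow2.
  by rewrite odd_mod //; apply/negbTE.
by rewrite divn2 even_halfK // ltn_mod.
Qed.

Lemma global_rule_word_pow2 f {L b} (c : config L) :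
  f false true false true false = true ->
  f true false true false true = true ->
  1 < L -> ~~ odd L -> val c = word_pow [:: b; ~~ b] (L %/ 2) ->
  global_rule f L c = const_config L true.
Proof.
move=> f0 f1 L_gt1 evenL cE; have L_gt0 := ltnW L_gt1.
apply: eq_const_config => k _; rewrite cell_global_rule //.
(* As [L] is even, parity survives the wrap-around, so every neighbourhood reads 01010 or 10101. *)
rewrite !(cell_word_pow2 _ L_gt0 evenL cE) !oddD !oddB // (negbTE evenL).
by case: b {cE} => /=; case: (odd k).
Qed.

Lemma block2E {L} (c : config L) j :
  block c j (j + 1) = [:: cell c j; cell c (j + 1)].
Proof. by rewrite /block /index_iota subSn ?leq_addr // addKn /= addn1. Qed.

Lemma block3E {L} (c : config L) j :
  block c j (j + 2) = [:: cell c j; cell c (j + 1); cell c (j + 2)].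
Proof.
by rewrite /block /index_iota subSn ?leq_addr // addKn /= addn1 addn2.
Qed.

(** Indices are cyclic, so [m] may exceed [L]; the run then covers the whole word. *)
Definition zero_run {L} (c : config L) a m :=
  forall k, k < m -> cell c (a + k) = false.

(** A run of [m.+2] zeros contains [m.+1] overlapping pairs 00. The shift [i] is the same for all of
    them, so their images 000 overlap in turn and join into one run of [m.+3] zeros. *)
Lemma zero_run_grow {L} (G : config L -> config L) i : 0 < L ->
  (forall (c : config L) j, j <= L - 1 ->
     block c j (j + 1) = [:: false; false] ->
     block (G c) (i + j) (i + j + 2) = [:: false; false; false]) ->
  forall c a m, zero_run c a m.+2 -> zero_run (G c) (i + a) m.+3.
Proof.
move=> L_gt0 G2 c a m run_c.
have run3 j k : j <= m -> k < 3 -> cell (G c) (i + a + (j + k)) = false.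
  move=> lejm ltk3.
  (* The hypothesis on [G] only accepts positions below [L], hence the reduction of [a + j]. *)
  have := G2 c ((a + j) %% L); rewrite block2E block3E cellDml.
  have -> : cell c ((a + j) %% L) = cell c (a + j) by rewrite /cell modn_mod.
  rewrite -addnA !run_c; [|lia..].
  have -> : (a + j) %% L <= L - 1 by have := ltn_pmod (a + j) L_gt0; lia.
  move=> /(_ isT erefl).
  rewrite -[i + _ %% L]addn0 ![i + _ %% L]addnC -!addnA !cellDml.
  have -> : i + (a + (j + k)) = a + j + (i + k) by lia.
  by case: k ltk3 => [|[|[|]]] // _ [? ? ?].
(* Cell [k] is read in the triple coming from pair [minn k m]; the last triple supplies the final
   two cells. *)
move=> k ltk; have -> : k = minn k m + (k - minn k m) by lia.
by apply: run3; lia.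
Qed.

Lemma iter_zero_run {L} (G : config L -> config L) i : 0 < L ->
  (forall (c : config L) j, j <= L - 1 ->
     block c j (j + 1) = [:: false; false] ->
     block (G c) (i + j) (i + j + 2) = [:: false; false; false]) ->
  forall c j, block c j (j + 1) = [:: false; false] ->
  exists t, iter t G c = const_config L false.
Proof.
move=> L_gt0 G2 c j; rewrite block2E => -[cj0 cj1].
have [a run_a] : exists a, zero_run (iter L G c) a L.+2.
  (* Only the number of iterations and the run length vary in the induction; the word length stays
     [L]. *)
  elim: {3 4}L => [|m [a run_a]]; last first.
    by exists (i + a); rewrite iterS; apply: zero_run_grow run_a.
  by exists j => -[|[|]] // _; rewrite ?addn0.
exists L; apply: eq_const_config => k ltkL.
(* This is the cyclic offset of cell [k] from the start [a] of the run, and it lies within the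
   run. *)
have ltkaL : (k + (L - a %% L)) %% L < L by rewrite ltn_mod.
rewrite -[RHS](run_a _ (leqW (leqW ltkaL))) /cell modnDmr -modnDml.
have -> : a %% L + (k + (L - a %% L)) = k + L.
  by have := ltn_pmod a L_gt0; lia.
by rewrite modnDr.
Qed.

Lemma iter_iterM {T} (F : T -> T) n t x : iter t (iter n F) x = iter (t * n) F x.
Proof. by elim: t => //= t ->; rewrite mulSn iterD. Qed.

Lemma attractor1 f L (c : config L) :
  global_rule f L c = c -> attractor f [set c].
Proof.
move=> fix_c; split; first by apply/set0Pn; exists c; rewrite set11.
  by rewrite imset_set1 fix_c.
by move=> Y Y0; rewrite subset1 (negbTE Y0) orbF => /eqP.
Qed.

(** Minimality of [X] is applied to the invariant subset [[set c]]. *)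
Lemma attractor_fixed_point f L (X : {set config L}) c :
  attractor f X -> c \in X -> global_rule f L c = c -> X = [set c].
Proof.
case=> _ _ minX Xc fix_c; apply/esym/minX.
- by apply/set0Pn; exists c; rewrite set11.
- by rewrite sub1set.
- by rewrite imset_set1 fix_c.
Qed.

Theorem corollary6 (f : local_rule) (n1 n2 : nat)
  (n1_ge1 : 1 <= n1) (n2_ge1 : 1 <= n2)
  (B1 : forall L : nat, 5 <= L -> forall c : config L,
     val c \notin (if odd L then [:: nseq L true]
                   else [:: nseq L true;
                            word_pow [:: false; true] (L %/ 2);
                            word_pow [:: true; false] (L %/ 2)]) ->
     exists j : nat, j <= L - 1 /\
       block (iter n1 (global_rule f L) c) j (j + 1) = [:: false; false])
  (B2 : forall L : nat, 5 <= L ->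
     exists i : nat, i <= L - 1 /\
       forall (c : config L) (j : nat), j <= L - 1 ->
         block c j (j + 1) = [:: false; false] ->
         block (iter n2 (global_rule f L) c) (i + j) (i + j + 2)
           = [:: false; false; false])
  (B3 : [/\ f false true false true false = true,
            f true false true false true = true &
            f true true true true true = true])
  (B4 : f false false false false false = false) :
  consensus_rule f /\
  forall L : nat, 5 <= L -> forall c : config L,
    in_basin f [set const_config L true] c <->
    val c \in (if odd L then [:: nseq L true]
               else [:: nseq L true;
                        word_pow [:: true; false] (L %/ 2);
                        word_pow [:: false; true] (L %/ 2)]).
Proof.
case: B3 => f01 f10 f11.
have const_fix L b : 5 <= L ->
    global_rule f L (const_config L b) = const_config L b.
  by move=> L_ge5; apply: global_rule_const; [lia | case: b].
have iter_const L b t : 5 <= L ->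
    iter t (global_rule f L) (const_config L b) = const_config L b.
  by move=> L_ge5; elim: t => //= t ->; apply: const_fix.
pose exc L := if odd L then [:: nseq L true]
              else [:: nseq L true; word_pow [:: true; false] (L %/ 2);
                       word_pow [:: false; true] (L %/ 2)].
have exc_to1 L (c : config L) : 5 <= L -> val c \in exc L ->
    global_rule f L c = const_config L true.
  move=> L_ge5; have c1 : val c = nseq L true ->
      global_rule f L c = const_config L true.
    move=> cE; rewrite -[RHS]const_fix //; congr (global_rule f L _).
    exact: val_inj.
  rewrite /exc; case: ifPn => oddL.
    by rewrite inE => /eqP.
  rewrite !inE => /or3P[] /eqP cE; first exact: c1.
    by apply: (global_rule_word_pow2 f _ f01 f10 _ oddL cE); lia.
  by apply: (global_rule_word_pow2 f _ f01 f10 _ oddL cE); lia.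
have nexc_to0 L (c : config L) : 5 <= L -> val c \notin exc L ->
    exists t, iter t (global_rule f L) c = const_config L false.
  move=> L_ge5 nexc.
  have [|j [_ c00]] := B1 L L_ge5 c.
    (* B1 lists the two alternating words in the opposite order to [exc]. *)
    move: nexc; rewrite /exc; case: ifP => // _.
    by rewrite !inE => /norP[n1c /norP[n10 n01]]; rewrite !negb_or n1c n01 n10.
  have [i [_ grow]] := B2 L L_ge5.
  have L_gt0 : 0 < L by lia.
  have [t] := iter_zero_run _ i L_gt0 grow _ _ c00.
  (* First [n1] steps create 00, then [t] rounds of [n2] steps spread it. *)
  by rewrite iter_iterM -iterD; exists (t * n2 + n1).
have basin1 L (c : config L) : 5 <= L ->
    in_basin f [set const_config L true] c <-> val c \in exc L.
  move=> L_ge5; split=> [[t]|exc_c]; last by exists 1; rewrite inE /= exc_to1.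
  (* If [c] reached $1^L$ at time [t] and $0^L$ at time [s], both constants would equal its iterate
     at time [s + t]. *)
  rewrite inE => /eqP t1; apply/negPn/negP => /(nexc_to0 L c L_ge5)[s s0].
  have := iter_const L false t L_ge5.
  rewrite -s0 -iterD addnC iterD t1 iter_const // s0.
  move=> /(congr1 (fun c0 : config L => cell c0 0)).
  by rewrite !cell_const_config //; lia.
split; last by move=> L L_ge5 c; apply: basin1.
move=> L L_ge5 X; split=> [attrX|]; last first.
  by case=> ->; apply/attractor1/const_fix.
have [/set0Pn[c Xc] imX _] := attrX.
have iterX t : iter t (global_rule f L) c \in X.
  by elim: t => //= t IHt; rewrite -imX imset_f.
(* The orbit of [c] stays in [X], so the constant word it reaches is a fixed point in [X], which
   determines [X]. *)
have [exc_c|/(nexc_to0 L c L_ge5)[t t0]] := boolP (val c \in exc L).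
  right; apply: attractor_fixed_point attrX _ (const_fix L _ L_ge5).
  by rewrite -(exc_to1 L c) //; apply: iterX 1.
left; apply: attractor_fixed_point attrX _ (const_fix L _ L_ge5).
by rewrite -t0.
Qed.
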